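(* Let $n\ge 2$, let $m_1,\dots,m_n>0$ and $\gamma>0$ be constants. Consider the autonomous system of first-order ordinary differential equations in the unknowns $\vec r_i=(x_i,y_i,z_i)\in\mathbb{R}^3$, $\vec v_i=(u_i,v_i,w_i)\in\mathbb{R}^3$ ($1\le i\le n$), $r_{ij}=r_{ji}\in\mathbb{R}\setminus\{0\}$ and $\rho_{ij}=\rho_{ji}\in\mathbb{R}$ ($i\neq j$), all regarded as independent variables: $$\dot{\vec r}_i=\vec v_i,\qquad m_i\dot{\vec v}_i=\sum_{j\ne i}\gamma\,\frac{m_im_j\rho_{ij}}{r_{ij}^2}\,(\vec r_j-\vec r_i),\qquad i=1,\dots,n,$$ $$\dot r_{ij}=\frac{1}{r_{ij}}(\vec r_i-\vec r_j)\cdot(\vec v_i-\vec v_j),\qquad \dot\rho_{ij}=-\frac{\rho_{ij}}{r_{ij}^2}(\vec r_i-\vec r_j)\cdot(\vec v_i-\vec v_j),\qquad i\ne j.$$ Then every symplectic Runge-Kutta scheme applied to this system, in particular the midpoint scheme $\hat x-x=f\left(\frac{\hat x+x}{2}\right)\Delta t$ (where $x$ is the vector of all unknowns and $f$ is the right-hand side of the system), preserves exactly each of the following quantities: $$\sum_{i=1}^n m_i\vec v_i,\qquad \sum_{i=1}^n m_i\,\vec v_i\times\vec r_i,\qquad \sum_{i=1}^n m_i\vec r_i-t\sum_{i=1}^n m_i\vec v_i,$$ $$\sum_{i=1}^n\frac{m_i}{2}(u_i^2+v_i^2+w_i^2)-\gamma\sum_{1\le i<j\le n}m_im_j\rho_{ij},$$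 $$r_{ij}^2-(x_i-x_j)^2-(y_i-y_j)^2-(z_i-z_j)^2\quad(i\ne j),\qquad r_{ij}\rho_{ij}\quad(i\neq j).$$
   Context: For an autonomous system $\dot x=f(x)$, an $s$-stage Runge-Kutta scheme with real coefficients $(a_{kl})_{k,l=1}^s$, $(b_k)_{k=1}^s$, $\sum_k b_k=1$, and time step $\Delta t$ relates the value $x$ at time $t$ to the value $\hat x$ at time $\hat t=t+\Delta t$ by $\hat x=x+\Delta t\sum_{k=1}^s b_k\kappa_k$, where $\kappa_k=f\big(x+\Delta t\sum_{l=1}^s a_{kl}\kappa_l\big)$, $k=1,\dots,s$, is a solution of the stage equations (with all arguments of $f$ in the domain where $f$ is defined). The scheme is symplectic if $b_ka_{kl}+b_la_{lk}=b_kb_l$ for all $k,l$. The scheme preserves a quantity $g(x,t)$ if $g(\hat x,\hat t)=g(x,t)$ for every $x,\hat x,t,\hat t$ related by a step of the scheme. The variables $r_{ij}$ and $\rho_{ij}$ are independent unknowns of the system and are not assumed to equal the distances $|\vec r_i-\vec r_j|$ and their reciprocals; there is one of each per unordered pair. The letter $v_i$ without an arrow denotes the second component of the vector $\vec v_i$; $\cdot$ and $\times$ are the scalar and vector products in $\mathbb{R}^3$. *)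

(* Defs.v *)
From HB Require Import structures.
From mathcomp Require Import all_boot all_order all_algebra.
From mathcomp Require Import reals.

Set Implicit Arguments.
Unset Strict Implicit.
Unset Printing Implicit Defensive.

Import Order.TTheory GRing.Theory Num.Theory.
Local Open Scope ring_scope.

Record rk_scheme (R : realType) := RKScheme {
  rk_stages : nat;
  rk_a : 'M[R]_rk_stages;
  rk_b : 'I_rk_stages -> R;
  rk_b_sum : \sum_k rk_b k = 1 }.

Arguments rk_a {R} _.
Arguments rk_b {R} _ _.

Definition symplectic (R : realType) (S : rk_scheme R) : Prop :=
  forall k l : 'I_(rk_stages S),
    rk_b S k * rk_a S k l + rk_b S l * rk_a S l k = rk_b S k * rk_b S l.

(* One step of a scheme for the system x' = f(x), where f is defined on D.
   The stage equations are implicit, so a step is a relation between x and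
   xhat, not a function. *)
Definition rk_step (R : realType) (V : lmodType R) (S : rk_scheme R)
    (D : V -> Prop) (f : V -> V) (dt : R) (x xhat : V) : Prop :=
  exists kappa : 'I_(rk_stages S) -> V,
    (forall k, let arg := x + dt *: \sum_l rk_a S k l *: kappa l in
               D arg /\ kappa k = f arg)
    /\ xhat = x + dt *: \sum_k rk_b S k *: kappa k.

Definition midpoint_step (R : realType) (V : lmodType R)
    (D : V -> Prop) (f : V -> V) (dt : R) (x xhat : V) : Prop :=
  let mid := 2^-1 *: (xhat + x) in D mid /\ xhat - x = dt *: f mid.

Definition preserves (R : realType) (V : lmodType R) (W : Type)
    (step : R -> V -> V -> Prop) (g : V -> R -> W) : Prop :=
  forall (dt t : R) (x xhat : V), step dt x xhat -> g xhat (t + dt) = g x t.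

Definition dot (R : realType) (u v : 'rV[R]_3) : R := \sum_k u 0 k * v 0 k.

(* Indices are in Z/3, so k + 1 and k + 2 wrap around cyclically. *)
Definition cross (R : realType) (u v : 'rV[R]_3) : 'rV[R]_3 :=
  \row_(k < 3) (u 0 (k + 1) * v 0 (k + 2) - u 0 (k + 2) * v 0 (k + 1)).

(* An unordered pair {i, j} with i != j, represented by its increasing form. *)
Definition upair (n : nat) : Type := {p : 'I_n * 'I_n | (p.1 < p.2)%N}.

(* Positions and velocities (one row per body), then the r_ij and the rho_ij. *)
Definition state (R : realType) (n : nat) : lmodType R :=
  ('M[R]_(n, 3) * 'M[R]_(n, 3) * {ffun upair n -> R^o} * {ffun upair n -> R^o})%type.

(* The entry of q at {i, j}, symmetric in i and j; the value 0 at i = j is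
   a dummy. *)
Definition at_pair (R : realType) (n : nat) (q : {ffun upair n -> R^o})
    (i j : 'I_n) : R :=
  if insub (if (i < j)%N then (i, j) else (j, i)) is Some p then q p else 0.

Section NBody.
Variables (R : realType) (n : nat) (m : 'I_n -> R) (gamma : R).
Implicit Type x : state R n.

Definition pos x (i : 'I_n) : 'rV[R]_3 := row i x.1.1.1.
Definition vel x (i : 'I_n) : 'rV[R]_3 := row i x.1.1.2.
Definition dist x (i j : 'I_n) : R := at_pair x.1.2 i j.
Definition rho x (i j : 'I_n) : R := at_pair x.2 i j.

Definition nbody_domain x : Prop :=
  forall i j : 'I_n, i != j -> dist x i j != 0.

Definition nbody_acc x (i : 'I_n) : 'rV[R]_3 :=
  (m i)^-1 *: \sum_(j < n | j != i)
    (gamma * (m i * m j * rho x i j / dist x i j ^+ 2)) *: (pos x j - pos x i).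

Definition nbody_ddist x (i j : 'I_n) : R :=
  1 / dist x i j * dot (pos x i - pos x j) (vel x i - vel x j).

Definition nbody_drho x (i j : 'I_n) : R :=
  - (rho x i j / dist x i j ^+ 2) * dot (pos x i - pos x j) (vel x i - vel x j).

Definition nbody_rhs x : state R n :=
  (\matrix_(i < n) vel x i,
   \matrix_(i < n) nbody_acc x i,
   [ffun p : upair n => nbody_ddist x (val p).1 (val p).2 : R^o],
   [ffun p : upair n => nbody_drho x (val p).1 (val p).2 : R^o]).

Definition momentum x (t : R) : 'rV[R]_3 := \sum_(i < n) m i *: vel x i.

Definition angular_momentum x (t : R) : 'rV[R]_3 :=
  \sum_(i < n) m i *: cross (vel x i) (pos x i).

Definition center_of_mass x (t : R) : 'rV[R]_3 :=
  \sum_(i < n) m i *: pos x i - t *: \sum_(i < n) m i *: vel x i.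

Definition energy x (t : R) : R :=
  \sum_(i < n) m i / 2 * (\sum_(k < 3) vel x i 0 k ^+ 2)
  - gamma * \sum_(i < n) \sum_(j < n | (i < j)%N) m i * m j * rho x i j.

Definition dist_defect (i j : 'I_n) x (t : R) : R :=
  dist x i j ^+ 2 - \sum_(k < 3) (pos x i 0 k - pos x j 0 k) ^+ 2.

Definition dist_rho (i j : 'I_n) x (t : R) : R := dist x i j * rho x i j.

Definition preserves_nbody_integrals (step : R -> state R n -> state R n -> Prop)
    : Prop :=
  [/\ preserves step momentum,
      preserves step angular_momentum,
      preserves step center_of_mass,
      preserves step energy &
      forall i j : 'I_n, i != j ->
        preserves step (dist_defect i j) /\ preserves step (dist_rho i j)].

End NBody.

(* Main.v *)
Require Import Defs.
From HB Require Import structures.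
From mathcomp Require Import all_boot all_order all_algebra.
From mathcomp Require Import reals.
From mathcomp Require Import ring.

(** The conserved quantities of the extended system are all at most quadratic
    in the unknowns, the factor t in the centre-of-mass integral aside: making
    the distances and their reciprocals independent variables is what turns the
    potential energy into a linear term and the relations between r, rho and
    the positions into quadratic ones.

    For a function q with differential dq, write Y_k for the argument of f at
    the k-th stage and kappa_k = f(Y_k).  The identity
      q(xhat) = q(x) + dt * sum_k b_k dq(Y_k)(kappa_k)                  (E)
    holds for linear q and any scheme.  For bilinear q the difference of the
    two sides is a multiple of dt^2 whose coefficients are
    b_k b_l - b_k a_kl - b_l a_lk, so the symplecticity condition is exactly
    what makes (E) hold as well ([rk_exact_bilinear]).  Hence a quadratic q is
    preserved as soon as dq(y)(f(y)) = 0 at every y in the domain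
    ([rk_exact_preserves]).

    That derivative is computed pairwise.  The forces obey the action-reaction
    law whatever the values of r and rho, so a sum over bodies of a linear
    function of the force collapses to a sum over pairs ([sum_force_linear]);
    momentum, angular momentum and energy follow by three choices of that
    linear function.  The centre of mass needs one more remark: the momentum is
    a linear invariant, hence keeps its initial value at every stage, and
    sum_k b_k = 1 then makes the first moment grow by exactly dt times it.

    The midpoint rule is the one-stage scheme with a = 1/2 and b = 1, which is
    symplectic. *)

Set Implicit Arguments.
Unset Strict Implicit.
Unset Printing Implicit Defensive.

Import Order.TTheory GRing.Theory Num.Theory.
Local Open Scope ring_scope.

(** * Quadratic functions along a Runge-Kutta step *)

Section Quadrature.
Variables (R : realType) (S : rk_scheme R).
Implicit Types V W : lmodType R.

Definition rk_node {V} (dt : R) (x : V) (kappa : 'I_(rk_stages S) -> V) k :=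
  x + dt *: \sum_l rk_a S k l *: kappa l.

(** The scheme computes the increment of q by its own quadrature formula
    applied to the derivative of q along the stages.  The stage vectors are
    arbitrary: (E) is an algebraic identity, and the differential equation
    enters only in [rk_exact_preserves].  Here dq x v stands for the derivative
    of q at x in the direction v. *)
Definition rk_exact {V W} (q : V -> W) (dq : V -> V -> W) : Prop :=
  forall (dt : R) (x : V) (kappa : 'I_(rk_stages S) -> V),
    q (x + dt *: \sum_k rk_b S k *: kappa k) =
    q x + dt *: \sum_k rk_b S k *: dq (rk_node dt x kappa k) (kappa k).

Lemma linear_affine_comb {V W} (l : V -> W) (l_linear : linear l) (N : nat)
    (c : 'I_N -> R) (dt : R) (x : V) (kappa : 'I_N -> V) :
  l (x + dt *: \sum_k c k *: kappa k) = l x + dt *: \sum_k c k *: l (kappa k).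
Proof.
pose L := HB.pack_for {linear V -> W} l
  (GRing.isLinear.Build R V W *:%R l l_linear).
rewrite -[l]/(L : V -> W) linearD linearZ linear_sum; congr (_ + _ *: _).
by apply: eq_bigr => k _; rewrite linearZ.
Qed.

Lemma rk_exact_linear {V W} (l : V -> W) :
  linear l -> rk_exact l (fun=> l).
Proof. by move=> hl dt x kappa; exact: linear_affine_comb. Qed.

(** Both sides agree up to first order in dt.  In second order, the left side
    has the coefficients b_k b_l, and the right side b_k a_kl and b_l a_lk after
    exchanging the two summation indices in one of its halves. *)
Lemma rk_exact_bilinear {V} {U1 U2 W : lmodType R} (l1 : V -> U1) (l2 : V -> U2)
    (B : U1 -> U2 -> W) :
  symplectic S -> linear l1 -> linear l2 ->
  (forall u, linear (B u)) -> (forall u, linear (B^~ u)) ->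
  rk_exact (fun x => B (l1 x) (l2 x))
           (fun x v => B (l1 x) (l2 v) + B (l1 v) (l2 x)).
Proof.
move=> hS h1 h2 hr hl dt x kappa.
have combl u N c (y : U1) (P : 'I_N -> U1) :
    B (y + dt *: \sum_k c k *: P k) u
    = B y u + dt *: \sum_k c k *: B (P k) u.
  exact: (linear_affine_comb (hl u)).
have combr u N c (y : U2) (P : 'I_N -> U2) :
    B u (y + dt *: \sum_k c k *: P k)
    = B u y + dt *: \sum_k c k *: B u (P k).
  exact: (linear_affine_comb (hr u)).
(* Expand both sides and cancel the terms of order 0, then those of order 1. *)
rewrite !(linear_affine_comb h1, linear_affine_comb h2) combl combr.
rewrite -addrA -scalerDr; congr (_ + _ *: _).
under [X in _ + X = _]eq_bigr do rewrite combr.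
rewrite -big_split /=.
under [RHS]eq_bigr do
  rewrite /rk_node !(linear_affine_comb h1, linear_affine_comb h2) combl combr
          addrACA -scalerDr.
under eq_bigr do rewrite scalerDr addrA -scalerDr.
under [RHS]eq_bigr do rewrite (scalerDr (rk_b S _)).
rewrite !big_split /=; congr (_ + _).
(* What remains are the double sums of order 2. *)
under eq_bigr do rewrite scalerA mulrC -scalerA scaler_sumr.
under [RHS]eq_bigr do rewrite scalerA mulrC -scalerA scalerDr !scaler_sumr.
rewrite -!scaler_sumr big_split /=; congr (_ *: _).
rewrite [X in _ = X + _]exchange_big -big_split /=; apply: eq_bigr => k _.
rewrite -big_split /=; apply: eq_bigr => l _.
by rewrite !scalerA -scalerDl -hS addrC.
Qed.

Lemma rk_exactD {V W} (q1 q2 : V -> W) dq1 dq2 :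
  rk_exact q1 dq1 -> rk_exact q2 dq2 ->
  rk_exact (fun x => q1 x + q2 x) (fun x v => dq1 x v + dq2 x v).
Proof.
move=> h1 h2 dt x kappa; rewrite h1 h2 addrACA -scalerDr -big_split /=.
by under [in RHS]eq_bigr do rewrite scalerDr.
Qed.

Lemma rk_exactZ {V W} (c : R) (q : V -> W) dq :
  rk_exact q dq -> rk_exact (fun x => c *: q x) (fun x v => c *: dq x v).
Proof.
move=> h dt x kappa; rewrite h scalerDr !scalerA mulrC -scalerA scaler_sumr.
congr (_ + _ *: _).
by apply: eq_bigr => k _; rewrite !scalerA mulrC.
Qed.

Lemma rk_exact_sum {V W} {I : finType} (P : pred I) (q : I -> V -> W) dq :
  (forall i, P i -> rk_exact (q i) (dq i)) ->
  rk_exact (fun x => \sum_(i | P i) q i x) (fun x v => \sum_(i | P i) dq i x v).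
Proof.
move=> h dt x kappa; under eq_bigr => i Pi do rewrite h //.
rewrite big_split /= -scaler_sumr exchange_big /=; congr (_ + _ *: _).
by apply: eq_bigr => k _; rewrite scaler_sumr.
Qed.

Lemma rk_exact_preserves {V W} (D : V -> Prop) (f : V -> V) (q : V -> W) dq :
  rk_exact q dq -> (forall y, D y -> dq y (f y) = 0) ->
  preserves (rk_step S D f) (fun x _ => q x).
Proof.
move=> hq h0 dt t x xhat [kappa [stage ->]]; rewrite hq big1 ?scaler0 ?addr0 //.
by move=> k _; have /= [Dk ->] := stage k; rewrite h0 ?scaler0.
Qed.

End Quadrature.

(** * Bilinear products *)

Section Products.
Variable R : realType.

Lemma mulr_linearr (u : R) : linear ( *%R u : R^o -> R^o).
Proof. by move=> a v w; rewrite mulrDr /GRing.scale/= mulrCA. Qed.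

Lemma mulr_linearl (u : R) : linear ( *%R^~ u : R^o -> R^o).
Proof. by move=> a v w; rewrite /= mulrDl /GRing.scale/= mulrA. Qed.

Lemma dotNN (u v : 'rV[R]_3) : dot (- u) (- v) = dot u v.
Proof. by apply: eq_bigr => k _; rewrite !mxE mulrNN. Qed.

Lemma dot_linearr (u : 'rV[R]_3) : linear (dot u : 'rV[R]_3 -> R^o).
Proof.
move=> a v w; rewrite /dot scaler_sumr -big_split /=.
by apply: eq_bigr => k _; rewrite !mxE mulrDr /GRing.scale/= mulrCA.
Qed.

Lemma dotC (u v : 'rV[R]_3) : dot u v = dot v u.
Proof. by apply: eq_bigr => k _; rewrite mulrC. Qed.

Lemma dot_linearl (u : 'rV[R]_3) : linear ((fun v => dot v u) : 'rV[R]_3 -> R^o).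
Proof. by move=> a v w; rewrite /= ![dot _ u]dotC dot_linearr. Qed.

Lemma cross_linearr (u : 'rV[R]_3) : linear (cross u).
Proof. by move=> a v w; apply/rowP => k; rewrite !mxE; ring. Qed.

Lemma cross_linearl (u : 'rV[R]_3) : linear (fun v => cross v u).
Proof. by move=> a v w; apply/rowP => k; rewrite !mxE; ring. Qed.

Lemma crossvv (u : 'rV[R]_3) : cross u u = 0.
Proof. by apply/rowP => k; rewrite !mxE; ring. Qed.

End Products.

(** * Coordinates and right-hand side of the n-body system *)

Section NBodyCoordinates.
Variables (R : realType) (n : nat) (m : 'I_n -> R) (gamma : R).
Let V : lmodType R := state R n.
Implicit Types (x : V) (i j : 'I_n).

Lemma pos_linear i : linear (fun x : V => pos x i).
Proof. by move=> a x y; rewrite /pos linearP. Qed.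

Lemma vel_linear i : linear (fun x : V => vel x i).
Proof. by move=> a x y; rewrite /vel linearP. Qed.

Lemma at_pair_linear i j :
  linear ((fun q => at_pair q i j) : {ffun upair n -> R^o} -> R^o).
Proof.
move=> a p q; rewrite /at_pair; case: insub => [k|]; first by rewrite !ffunE.
by rewrite scaler0 addr0.
Qed.

Lemma dist_linear i j : linear ((fun x => dist x i j) : V -> R^o).
Proof. by move=> a x y; exact: at_pair_linear. Qed.

Lemma rho_linear i j : linear ((fun x => rho x i j) : V -> R^o).
Proof. by move=> a x y; exact: at_pair_linear. Qed.

Lemma at_pair_sym (q : {ffun upair n -> R^o}) i j : at_pair q i j = at_pair q j i.
Proof. by rewrite /at_pair; case: ltngtP => // /val_inj ->. Qed.

Lemma at_pair_finfun (F : 'I_n -> 'I_n -> R) i j :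
  F i j = F j i -> i != j ->
  at_pair [ffun p : upair n => F (val p).1 (val p).2 : R^o] i j = F i j.
Proof.
move=> Fsym ij; rewrite /at_pair.
case: ltngtP => [lij|lji|/val_inj e]; last by rewrite e eqxx in ij.
  by rewrite insubT /= ffunE.
by rewrite insubT /= ffunE /= Fsym.
Qed.

Lemma sum_offdiag {W : nmodType} (G : 'I_n -> 'I_n -> W) :
  \sum_(i < n) \sum_(j < n | j != i) G i j =
  \sum_(i < n) \sum_(j < n | (i < j)%N) (G i j + G j i).
Proof.
under [RHS]eq_bigr do rewrite big_split.
rewrite big_split /= [X in _ = _ + X](exchange_big_dep predT) //= -big_split /=.
apply: eq_bigr => i _; rewrite (bigID (fun j : 'I_n => (i < j)%N)) /=.
by congr (_ + _); apply: eq_bigl => j; rewrite -val_eqE /=; case: ltngtP.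
Qed.

Lemma pos_rhs x i : pos (nbody_rhs m gamma x : V) i = vel x i.
Proof. by rewrite /pos rowK. Qed.

Lemma vel_rhs x i : vel (nbody_rhs m gamma x : V) i = nbody_acc m gamma x i.
Proof. by rewrite /vel rowK. Qed.

Lemma dist_rhs x i j : i != j ->
  dist (nbody_rhs m gamma x : V) i j = nbody_ddist x i j.
Proof.
move=> ij; apply: at_pair_finfun => //.
by rewrite /nbody_ddist /dist at_pair_sym -dotNN !opprB.
Qed.

Lemma rho_rhs x i j : i != j ->
  rho (nbody_rhs m gamma x : V) i j = nbody_drho x i j.
Proof.
move=> ij; apply: at_pair_finfun => //.
by rewrite /nbody_drho /dist /rho !(at_pair_sym _ i j) -dotNN !opprB.
Qed.

End NBodyCoordinates.

(** * The midpoint rule as a Runge-Kutta scheme *)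

Section Midpoint.
Variable R : realType.

Lemma midpoint_b_sum : \sum_(k < 1) (1 : R) = 1.
Proof. by rewrite big_ord1. Qed.

Definition midpoint_scheme : rk_scheme R :=
  @RKScheme R 1 (const_mx 2^-1) (fun=> 1) midpoint_b_sum.

Lemma midpoint_symplectic : symplectic midpoint_scheme.
Proof. by move=> k l; rewrite /= !mxE mulr1 -splitr. Qed.

Lemma midpoint_schemeP (V : lmodType R) (D : V -> Prop) (f : V -> V) dt x xhat :
  rk_step midpoint_scheme D f dt x xhat <-> midpoint_step D f dt x xhat.
Proof.
(* With one stage, the argument of f is the mean of the two endpoints. *)
have node v : x + dt *: (2^-1 *: v) = 2^-1 *: (x + dt *: v + x).
  rewrite addrAC scalerDr -mulr2n -[x *+ 2]scaler_nat !scalerA.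
  by rewrite mulVf ?pnatr_eq0 // scale1r mulrC.
rewrite /midpoint_step; split.
  case=> kappa [stage ->]; have := stage ord0.
  rewrite /= !big_ord1 mxE node scale1r => -[Dm e]; split=> //.
  by rewrite addrC addKr -e.
case=> Dm e; exists (fun=> f (2^-1 *: (xhat + x))).
have {}e : xhat = x + dt *: f (2^-1 *: (xhat + x)) by rewrite -e addrC subrK.
split; last by rewrite big_ord1 scale1r.
by move=> k; rewrite /= big_ord1 mxE node -e.
Qed.

End Midpoint.

(** * The integrals of the n-body system *)

Section Integrals.
Variables (R : realType) (n : nat) (m : 'I_n -> R) (gamma : R).
Hypothesis m_gt0 : forall i, 0 < m i.
Let V : lmodType R := state R n.
Let f : V -> V := nbody_rhs m gamma.
Implicit Types (x : V) (i j : 'I_n).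

Definition force_coef x i j : R :=
  gamma * (m i * m j * rho x i j / dist x i j ^+ 2).

Lemma force_coefC x i j : force_coef x i j = force_coef x j i.
Proof. by rewrite /force_coef /rho /dist !(at_pair_sym _ i j) (mulrC (m i)). Qed.

(** Action and reaction: the force on i due to j is the opposite of the force on
    j due to i, because the coefficient is symmetric in the pair.  The term of
    the pair {i, j} is therefore one vector seen through B i minus the same
    vector seen through B j. *)
Lemma sum_force_linear {W : lmodType R} (B : 'I_n -> 'rV[R]_3 -> W) x :
  (forall i, linear (B i)) ->
  \sum_i m i *: B i (vel (f x) i) =
  \sum_(i < n) \sum_(j < n | (i < j)%N) force_coef x i j *:
    (B i (pos x j - pos x i) - B j (pos x j - pos x i)).
Proof.
move=> hB.
pose L i := HB.pack_for {linear 'rV[R]_3 -> W} (B i)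
  (GRing.isLinear.Build R _ W *:%R (B i) (hB i)).
have term i : m i *: B i (vel (f x) i) =
    \sum_(j | j != i) force_coef x i j *: B i (pos x j - pos x i).
  rewrite -[B i]/(L i : _ -> _) vel_rhs /nbody_acc linearZ scalerA.
  rewrite divff ?gt_eqF // scale1r linear_sum.
  by apply: eq_bigr => j _; rewrite linearZ.
under eq_bigr do rewrite term.
rewrite sum_offdiag; apply: eq_bigr => i _; apply: eq_bigr => j _.
rewrite (force_coefC x j i) -scalerDr -[pos x i - _]opprB.
by rewrite -[B j]/(L j : _ -> _) linearN.
Qed.

Lemma momentum_rhs x : momentum m (f x) 0 = 0.
Proof.
have := @sum_force_linear _ (fun=> id) x; rewrite /momentum => -> //.
by rewrite big1 // => i _; rewrite big1 // => j _; rewrite subrr scaler0.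
Qed.

(** Forces are central: the pair {i, j} contributes a multiple of
    (r_j - r_i) x (r_i - r_j) = 0. *)
Lemma torque0 x : \sum_i m i *: cross (vel (f x) i) (pos x i) = 0.
Proof.
rewrite (sum_force_linear (B := fun i v => cross v (pos x i))); last first.
  by move=> i; exact: cross_linearl.
rewrite big1 // => i _; rewrite big1 // => j _.
by rewrite (_ : _ - _ = 0) ?scaler0 //; apply/rowP => k; rewrite !mxE; ring.
Qed.

(** The power of the forces is gamma times the derivative of the weighted sum of
    the rho_ij: the equation for rho_ij has exactly the factor rho_ij / r_ij^2
    of the force. *)
Lemma power_balance x :
  \sum_i m i *: (dot (vel x i) (vel (f x) i) : R^o) =
  gamma *: (\sum_(i < n) \sum_(j < n | (i < j)%N)
              (m i * m j) *: (rho (f x) i j : R^o)).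
Proof.
rewrite (sum_force_linear (B := fun i => dot (vel x i) : _ -> R^o)); last first.
  by move=> i; exact: dot_linearr.
rewrite scaler_sumr; apply: eq_bigr => i _; rewrite scaler_sumr.
apply: eq_bigr => j ij; rewrite rho_rhs -?val_eqE /= ?ltn_eqF //.
rewrite /nbody_drho /force_coef /dot /GRing.scale /= !big_ord_recl !big_ord0 !mxE.
ring.
Qed.

Lemma dist_mul_rhs x i j : i != j -> dist x i j != 0 ->
  dist x i j * dist (f x) i j =
  dot (pos x i - pos x j) (pos (f x) i - pos (f x) j).
Proof.
by move=> ij nz; rewrite dist_rhs // !pos_rhs /nbody_ddist div1r mulVKf.
Qed.

Lemma dist_rho_rhs x i j : i != j -> dist x i j != 0 ->
  dist x i j * rho (f x) i j + dist (f x) i j * rho x i j = 0.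
Proof.
by move=> ij nz; rewrite dist_rhs // rho_rhs // /nbody_ddist /nbody_drho; field.
Qed.

Lemma momentum_linear : linear (fun x : V => momentum m x 0).
Proof.
move=> a x y; rewrite /momentum scaler_sumr -big_split /=.
by apply: eq_bigr => i _; rewrite vel_linear scalerDr !scalerA mulrC.
Qed.

Lemma moment_linear : linear (fun x : V => \sum_i m i *: pos x i).
Proof.
move=> a x y; rewrite scaler_sumr -big_split /=.
by apply: eq_bigr => i _; rewrite pos_linear scalerDr !scalerA mulrC.
Qed.

Variable S : rk_scheme R.
Let D : V -> Prop := @nbody_domain R n.
Let step := rk_step S D f.

Lemma momentum_preserved : preserves step (momentum m).
Proof.
apply: (@rk_exact_preserves _ S _ _ D f (fun x => momentum m x 0)).
  exact: rk_exact_linear momentum_linear.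
by move=> y _; exact: momentum_rhs.
Qed.

(** The factor t puts this quantity outside (E).  Its linear part is the first
    moment, whose increment is dt times the b-weighted mean of the momentum at
    the stages. *)
Lemma center_of_mass_preserved : preserves step (center_of_mass m).
Proof.
move=> dt t x xhat st; rewrite /center_of_mass.
have -> : \sum_i m i *: vel xhat i = momentum m x 0 := momentum_preserved 0 st.
rewrite -[\sum_i m i *: vel x i]/(momentum m x 0).
case: st => kappa [stage ->].
rewrite (linear_affine_comb moment_linear).
rewrite (eq_bigr (fun k => rk_b S k *: momentum m x 0)); last first.
  move=> k _; congr (_ *: _); have /= [Dk ->] := stage k.
  under eq_bigr do rewrite pos_rhs.
  (* The stages keep the initial momentum: it is linear and vanishes on f. *)
  rewrite -[LHS]/(momentum m _ 0) (linear_affine_comb momentum_linear).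
  rewrite big1 ?scaler0 ?addr0 // => l _; have /= [_ ->] := stage l.
  by rewrite momentum_rhs scaler0.
by rewrite -scaler_suml rk_b_sum scale1r scalerDl opprD addrACA subrr addr0.
Qed.

Hypothesis hS : symplectic S.

Lemma angular_momentum_preserved : preserves step (angular_momentum m).
Proof.
apply: (@rk_exact_preserves _ S _ _ D f (fun x => angular_momentum m x 0)).
  apply: rk_exact_sum => i _; apply: rk_exactZ.
  apply: rk_exact_bilinear => //.
  - exact: vel_linear.
  - exact: pos_linear.
  - exact: cross_linearr.
  - exact: cross_linearl.
move=> y _ /=; under eq_bigr do rewrite pos_rhs crossvv add0r.
exact: torque0.
Qed.

Lemma energy_preserved : preserves step (energy m gamma).
Proof.
pose q (x : V) : R^o := \sum_i (m i / 2) *: (dot (vel x i) (vel x i) : R^o)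
  + (- gamma) *: (\sum_(i < n) \sum_(j < n | (i < j)%N)
                    (m i * m j) *: (rho x i j : R^o)).
have qE x t : energy m gamma x t = q x.
  by rewrite /energy /q scaleNr.
suff hq : preserves step (fun x _ => q x).
  by move=> dt t x xhat st; rewrite !qE; exact: (hq dt t).
apply: (@rk_exact_preserves _ S V R^o D f).
  apply: rk_exactD.
    apply: rk_exact_sum => i _; apply: rk_exactZ.
    apply: (@rk_exact_bilinear _ S V _ _ R^o _ _ (@dot R)) => //.
    - exact: vel_linear.
    - exact: vel_linear.
    - exact: dot_linearr.
    - exact: dot_linearl.
  apply: rk_exactZ; apply: rk_exact_sum => i _; apply: rk_exact_sum => j _.
  apply: rk_exactZ; apply: rk_exact_linear; exact: rho_linear.
move=> y _ /=; rewrite scaleNr -power_balance.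
apply/eqP; rewrite subr_eq0; apply/eqP; apply: eq_bigr => i _.
by rewrite [dot (vel (f y) i) _]dotC -mulr2n -scaler_nat scalerA divfK ?pnatr_eq0.
Qed.

Lemma dist_rho_preserved i j : i != j -> preserves step (@dist_rho R n i j).
Proof.
move=> ij; apply: (@rk_exact_preserves _ S V R^o D f (fun x => dist_rho i j x 0)).
  apply: (@rk_exact_bilinear _ S V R^o R^o R^o _ _ *%R) => //.
  - exact: dist_linear.
  - exact: rho_linear.
  - exact: mulr_linearr.
  - exact: mulr_linearl.
by move=> y Dy; exact: dist_rho_rhs ij (Dy i j ij).
Qed.

Lemma dist_defect_preserved i j : i != j -> preserves step (@dist_defect R n i j).
Proof.
move=> ij.
pose q (x : V) : R^o := (dist x i j * dist x i j : R^o)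
  + (-1) *: (dot (pos x i - pos x j) (pos x i - pos x j) : R^o).
have qE x t : dist_defect i j x t = q x.
  rewrite /dist_defect /q scaleN1r expr2; congr (_ - _).
  by apply: eq_bigr => k _; rewrite !mxE expr2.
have hl : linear (fun x : V => pos x i - pos x j).
  by move=> a x y; rewrite !pos_linear scalerBr opprD addrACA.
suff hq : preserves step (fun x _ => q x).
  by move=> dt t x xhat st; rewrite !qE; exact: (hq dt t).
apply: (@rk_exact_preserves _ S V R^o D f).
  apply: rk_exactD.
    apply: (@rk_exact_bilinear _ S V R^o R^o R^o _ _ *%R) => //.
    - exact: dist_linear.
    - exact: dist_linear.
    - exact: mulr_linearr.
    - exact: mulr_linearl.
  apply: rk_exactZ.
  apply: (@rk_exact_bilinear _ S V _ _ R^o _ _ (@dot R)) => //.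
  - exact: dot_linearr.
  - exact: dot_linearl.
move=> y Dy /=; rewrite scaleN1r (mulrC (dist (f y) i j)).
by rewrite dist_mul_rhs ?Dy // [dot (_ (f y) _ - _) _]dotC subrr.
Qed.

Lemma symplectic_preserves_nbody_integrals :
  preserves_nbody_integrals m gamma step.
Proof.
split.
- exact: momentum_preserved.
- exact: angular_momentum_preserved.
- exact: center_of_mass_preserved.
- exact: energy_preserved.
- by move=> i j ij; split; [exact: dist_defect_preserved|exact: dist_rho_preserved].
Qed.

End Integrals.

Unset Implicit Arguments.

Theorem mainTheorem3 (R : realType) (n : nat) (m : 'I_n -> R) (gamma : R)
    (hn : (2 <= n)%N) (hm : forall i, 0 < m i) (hgamma : 0 < gamma) :
  let D := @nbody_domain R n in
  let f := nbody_rhs m gamma in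
  [/\ forall S : rk_scheme R, symplectic S ->
        preserves_nbody_integrals m gamma (rk_step S D f),
      exists S : rk_scheme R, symplectic S /\
        forall (dt : R) (x xhat : state R n),
          rk_step S D f dt x xhat <-> midpoint_step D f dt x xhat
    & preserves_nbody_integrals m gamma (midpoint_step D f)].
Proof.
move=> D f.
have symp S : symplectic S -> preserves_nbody_integrals m gamma (rk_step S D f).
  exact: symplectic_preserves_nbody_integrals.
split=> //.
  exists (midpoint_scheme R); split; first exact: midpoint_symplectic.
  by move=> dt x xhat; exact: midpoint_schemeP.
have [h1 h2 h3 h4 h5] := symp _ (@midpoint_symplectic R).
split=> [||||i j ij].
- by move=> dt t x xhat /midpoint_schemeP; exact: h1.
- by move=> dt t x xhat /midpoint_schemeP; exact: h2.
- by move=> dt t x xhat /midpoint_schemeP; exact: h3.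
- by move=> dt t x xhat /midpoint_schemeP; exact: h4.
- have [h6 h7] := h5 i j ij.
  split=> dt t x xhat /midpoint_schemeP; [exact: h6|exact: h7].
Qed.
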